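(* Let $A\subset\mathbb{R}^n$ with $0\in\overline{A}$, and let $h:(\mathbb{R}^n,0)\to(\mathbb{R}^n,0)$ be a bi-Lipschitz homeomorphism. Assume that $A$ satisfies condition $(SSP)$ at every $p\in\overline{A}$ in a small enough neighbourhood of the origin. Let $D\subseteq A$ be a subset with $0\in\overline{D}$ such that $$L\mathcal{GD}(A)\subseteq\overline{\bigcup_{p\in U\cap D}LD_p(A)}\quad\text{for every neighbourhood } U \text{ of the origin},$$ and such that $d_ph$ converges to a single map $\tilde h$ as $p\to 0$, $p\in D$ (i.e. $\lim_{p\to0,\,p\in D}d_ph=\tilde h$). Then $h$ is $A$-directional at $0$ and $$\tilde h\bigl(L\mathcal{GD}(A)\bigr)\subseteq L\mathcal{GD}(h(A)).$$ Moreover, if $h(A)$ also satisfies condition $(SSP)$ at every point near the origin and $h^{-1}$ is $h(A)$-directional at $0$, then this inclusion is an equality.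
   Context: Direction set: for $A\subset\mathbb{R}^n$ and $p\in\overline A$, $D_p(A)$ is the set of $a\in S^{n-1}$ for which there is a sequence $x_i\in A\setminus\{p\}$ with $x_i\to p$ and $\frac{x_i-p}{\|x_i-p\|}\to a$. The real tangent cone is $LD_p(A):=\{ta\mid a\in D_p(A),\ t\ge 0\}$. Condition $(SSP)$: $A$ satisfies $(SSP)$ at $p\in\overline A$ if for every sequence $a_m\in\mathbb{R}^n\setminus\{p\}$ tending to $p$ with $\lim_{m\to\infty}\frac{a_m-p}{\|a_m-p\|}\in D_p(A)$ there is a sequence $b_m\in A$ with $\|a_m-b_m\|\ll\|a_m-p\|,\ \|b_m-p\|$, i.e. $\|a_m-b_m\|/\|a_m-p\|\to0$ and $\|a_m-b_m\|/\|b_m-p\|\to 0$ as $m\to\infty$. Geometric directional bundle at $0$: $\mathcal{GD}(A)$ is the set of $a\in S^{n-1}$ such that $(0,a)$ belongs to the closure in $\mathbb{R}^n\times S^{n-1}$ of $\{(q,b)\mid q\in A,\ b\in D_q(A)\}$, and $L\mathcal{GD}(A):=\{tv\mid v\in\mathcal{GD}(A),\ t\ge0\}$. A bi-Lipschitz homeomorphism $h:(\mathbb{R}^n,0)\to(\mathbb{R}^n,0)$ is a homeomorphism between neighbourhoods of $0$, with $h(0)=0$, such that $h$ and $h^{-1}$ are Lipschitz; sets are considered near $0$ (as germs). Arzelà–Ascoli derivative: for $p$ near $0$, $d_ph:\mathbb{R}^n\to\mathbb{R}^n$ denotes a map obtained as a limit, uniform on compact sets, of $v\mapsto\frac{h(p+t_iv)-h(p)}{t_i}$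 for some sequence $t_i>0$, $t_i\to0$ (such limits exist by the Arzelà–Ascoli theorem and are bi-Lipschitz homeomorphisms with the same Lipschitz constants as $h$). For each $p\in D$ one such $d_ph$ is fixed, and convergence of $d_ph$ to $\tilde h$ means uniform convergence on compact sets. $A$-directional: $h$ is $A$-directional at $0\in\overline A$ if there are a subset $D\subseteq A$ with $0\in\overline D$, Arzelà–Ascoli derivatives $d_ph$ ($p\in D$) and a map $\tilde h$ such that $d_ph\to\tilde h$ as $p\to0$, $p\in D$; $d_ph(LD_p(A))\subseteq LD_{h(p)}(h(A))$ for $p\in D$; and $L\mathcal{GD}(A)\subseteq\overline{\bigcup_{p\in U\cap D}LD_p(A)}$ for all neighbourhoods $U$ of $0$.
   Formalization: In the ''moreover'' part, directionality of the inverse of h must be compatible with the given data: its set lies in h(D), or its limit map is a left inverse of the limit map of h; with unrelated data equality can fail. The limit as p→0 in D includes p=0 when 0 is in D. *)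

(* Defs.v *)
From HB Require Import structures.
From mathcomp Require Import all_boot all_order all_algebra.
From mathcomp Require Import all_classical all_reals all_analysis.
Set Implicit Arguments.
Unset Strict Implicit.
Unset Printing Implicit Defensive.
Import Order.TTheory GRing.Theory Num.Theory.
Import numFieldNormedType.Exports.
Local Open Scope classical_set_scope.
Local Open Scope ring_scope.

(* The library norm on 'rV[R]_n is the sup norm; it induces the usual
   topology, which is the one used below.  Directions and Lipschitz conditions
   refer to the Euclidean norm. *)
Definition enorm (R : realType) (n : nat) (v : 'rV[R]_n) : R :=
  Num.sqrt (\sum_(i < n) v 0 i ^+ 2).

Definition direction (R : realType) (n : nat) (p x : 'rV[R]_n) : 'rV[R]_n :=
  (enorm (x - p))^-1 *: (x - p).

Definition direction_set (R : realType) (n : nat) (A : set 'rV[R]_n)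
    (p : 'rV[R]_n) : set 'rV[R]_n :=
  [set a | enorm a = 1 /\
    exists x : nat -> 'rV[R]_n,
      [/\ forall i, A (x i) /\ x i <> p,
          x i @[i --> \oo] --> p
        & direction p (x i) @[i --> \oo] --> a]].

(* Empty when S is empty; in particular the tangent cone at an isolated point
   is empty. *)
Definition cone (R : realType) (n : nat) (S : set 'rV[R]_n) : set 'rV[R]_n :=
  [set v | exists2 a, S a & exists2 t : R, 0 <= t & v = t *: a].

Definition tangent_cone (R : realType) (n : nat) (A : set 'rV[R]_n)
    (p : 'rV[R]_n) : set 'rV[R]_n :=
  cone (direction_set A p).

(* If b m = p the second quotient is 0 by convention, but the first one is
   then 1, so the first limit already forces b m <> p for large m. *)
Definition SSP (R : realType) (n : nat) (A : set 'rV[R]_n)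
    (p : 'rV[R]_n) : Prop :=
  forall a : nat -> 'rV[R]_n,
    (forall m, a m <> p) ->
    a m @[m --> \oo] --> p ->
    (exists2 d, direction_set A p d & direction p (a m) @[m --> \oo] --> d) ->
    exists b : nat -> 'rV[R]_n,
      [/\ forall m, A (b m),
          (enorm (a m - b m) / enorm (a m - p) : R) @[m --> \oo] --> (0 : R)
        & (enorm (a m - b m) / enorm (b m - p) : R) @[m --> \oo] --> (0 : R)].

Definition SSP_near0 (R : realType) (n : nat) (A : set 'rV[R]_n) : Prop :=
  \forall p \near (0 : 'rV[R]_n), closure A p -> SSP A p.

Definition GD (R : realType) (n : nat) (A : set 'rV[R]_n) : set 'rV[R]_n :=
  [set a | enorm a = 1 /\
    closure [set qb : 'rV[R]_n * 'rV[R]_n |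
              A qb.1 /\ direction_set A qb.1 qb.2] (0, a)].

Definition LGD (R : realType) (n : nat) (A : set 'rV[R]_n) : set 'rV[R]_n :=
  cone (GD A).

Definition lipschitz_in (R : realType) (n : nat) (U : set 'rV[R]_n)
    (f : 'rV[R]_n -> 'rV[R]_n) : Prop :=
  exists L : R, forall x y, U x -> U y ->
    enorm (f x - f y) <= L * enorm (x - y).

(* The values of bl_fun outside bl_dom and of bl_inv outside bl_cod are
   irrelevant.  Continuity of both maps follows from the Lipschitz bounds. *)
Record bilip_germ (R : realType) (n : nat) := BilipGerm {
  bl_fun :> 'rV[R]_n -> 'rV[R]_n;
  bl_inv : 'rV[R]_n -> 'rV[R]_n;
  bl_dom : set 'rV[R]_n;
  bl_cod : set 'rV[R]_n;
  bl_dom_nbhs : nbhs (0 : 'rV[R]_n) bl_dom;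
  bl_cod_nbhs : nbhs (0 : 'rV[R]_n) bl_cod;
  bl_fun0 : bl_fun 0 = 0;
  bl_inv0 : bl_inv 0 = 0;
  bl_fun_cod : forall x, bl_dom x -> bl_cod (bl_fun x);
  bl_inv_dom : forall y, bl_cod y -> bl_dom (bl_inv y);
  bl_funK : forall x, bl_dom x -> bl_inv (bl_fun x) = x;
  bl_invK : forall y, bl_cod y -> bl_fun (bl_inv y) = y;
  bl_fun_lip : lipschitz_in bl_dom bl_fun;
  bl_inv_lip : lipschitz_in bl_cod bl_inv }.

Definition germ_inv (R : realType) (n : nat) (h : bilip_germ R n) :
    bilip_germ R n :=
  BilipGerm (bl_cod_nbhs h) (bl_dom_nbhs h) (bl_inv0 h) (bl_fun0 h)
    (bl_inv_dom (b := h)) (bl_fun_cod (b := h)) (bl_invK (b := h))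
    (bl_funK (b := h)) (bl_inv_lip h) (bl_fun_lip h).

Definition germ_image (R : realType) (n : nat) (h : bilip_germ R n)
    (A : set 'rV[R]_n) : set 'rV[R]_n :=
  h @` (A `&` bl_dom h).

Definition AA_derivative (R : realType) (n : nat)
    (h : 'rV[R]_n -> 'rV[R]_n) (p : 'rV[R]_n)
    (g : 'rV[R]_n -> 'rV[R]_n) : Prop :=
  exists t : nat -> R,
    [/\ forall i, 0 < t i,
        t i @[i --> \oo] --> (0 : R)
      & {family compact,
          (fun (i : nat) (v : 'rV[R]_n) => (t i)^-1 *: (h (p + t i *: v) - h p))
            @ \oo --> g}].

Definition AA_family (R : realType) (n : nat) (h : 'rV[R]_n -> 'rV[R]_n)
    (D : set 'rV[R]_n) (dh : 'rV[R]_n -> 'rV[R]_n -> 'rV[R]_n) : Prop :=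
  \forall p \near (0 : 'rV[R]_n), D p -> AA_derivative h p (dh p).

(* The point p = 0 is not removed from the limit when 0 \in D. *)
Definition AA_limit (R : realType) (n : nat) (D : set 'rV[R]_n)
    (dh : 'rV[R]_n -> 'rV[R]_n -> 'rV[R]_n)
    (ht : 'rV[R]_n -> 'rV[R]_n) : Prop :=
  {family compact, dh @ within D (nbhs (0 : 'rV[R]_n)) --> ht}.

Definition cones_cover (R : realType) (n : nat) (A D : set 'rV[R]_n) : Prop :=
  forall U : set 'rV[R]_n, nbhs (0 : 'rV[R]_n) U ->
    LGD A `<=` closure (\bigcup_(p in U `&` D) tangent_cone A p).

Definition directional_along (R : realType) (n : nat) (h : bilip_germ R n)
    (A D : set 'rV[R]_n) (dh : 'rV[R]_n -> 'rV[R]_n -> 'rV[R]_n)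
    (ht : 'rV[R]_n -> 'rV[R]_n) : Prop :=
  [/\ D `<=` A /\ closure D 0,
      AA_family h D dh,
      AA_limit D dh ht,
      \forall p \near (0 : 'rV[R]_n), D p ->
        dh p @` tangent_cone A p `<=` tangent_cone (germ_image h A) (h p)
    & cones_cover A D].

Definition directional (R : realType) (n : nat) (h : bilip_germ R n)
    (A : set 'rV[R]_n) : Prop :=
  exists D dh ht, directional_along h A D dh ht.

(* Directionality is existential in the set and in the limit map, so the
   witnesses for the inverse germ can be unrelated to the set D and limit ht
   chosen for h: h may have limit derivative T along D and the identity along
   another sequence of points of A, and then ht @` LGD A can be a proper subset
   of LGD of the image.  The witnesses are tied to D and ht by either of:
   the set is transported from D, or the limit is the inverse of ht. *)
Definition compatible (R : realType) (n : nat) (h : bilip_germ R n)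
    (D : set 'rV[R]_n) (ht : 'rV[R]_n -> 'rV[R]_n)
    (E : set 'rV[R]_n) (kt : 'rV[R]_n -> 'rV[R]_n) : Prop :=
  E `<=` germ_image h D \/ cancel ht kt.

(* Main.v *)
Require Import Defs.
From mathcomp Require Import all_boot all_order all_algebra.
From mathcomp Require Import all_classical all_reals all_analysis.
From mathcomp Require Import ring lra.
Import Order.TTheory GRing.Theory Num.Theory.
Import numFieldNormedType.Exports.
Local Open Scope classical_set_scope.
Local Open Scope ring_scope.

(* Fix p in D and let t_i -> 0 be the sequence defining d_p h.  If v is tangent
   to A at p, then (SSP) supplies b_i in A with b_i = p + t_i v + o(t_i), so the
   difference quotients of h along b_i converge to d_p h (v), which is therefore
   tangent to h(A) at h(p).  Letting p -> 0 in D, the equi-Lipschitz maps d_p h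
   carry vectors of LD_p(A) close to v in LGD(A) to tangent vectors of h(A)
   close to ht(v), which gives ht(LGD(A)) included in LGD(h(A)).

   For equality there are two cases.  If kt inverts ht on the left, the
   inclusion for the inverse germ puts kt(w) in LGD(A), and ht(kt(w)) = w because
   kt is injective.  If E lies in h(D), then (SSP) for h(A) gives
   LD_{h(p)}(h(A)) included in d_p h (LD_p(A)): preimages of a sequence in h(A)
   with direction w have bounded difference quotients, whose cluster points are
   tangent to A and are sent to w.  A second extraction of a cluster point, as
   p -> 0, writes each w in LGD(h(A)) as ht(v) with v in LGD(A). *)

(** * The Euclidean norm and the topology it induces *)

Section enorm.
Context {R : realType} {n : nat}.
Implicit Types (u v w p : 'rV[R]_n).

Lemma enorm_ge0 v : 0 <= enorm v.
Proof. exact: sqrtr_ge0. Qed.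

Lemma sqr_enorm v : enorm v ^+ 2 = \sum_(i < n) v 0 i ^+ 2.
Proof. by rewrite sqr_sqrtr // sumr_ge0 // => i _; exact: sqr_ge0. Qed.

Lemma enorm0 : enorm (0 : 'rV[R]_n) = 0.
Proof.
by rewrite /enorm big1 ?sqrtr0 // => i _; rewrite mxE expr0n.
Qed.

Lemma enorm_eq0 v : (enorm v == 0) = (v == 0).
Proof.
apply/eqP/eqP => [v0|->]; last exact: enorm0.
have := sqr_enorm v; rewrite v0 expr0n /= => /esym/eqP.
rewrite psumr_eq0 => [/allP s0|i _]; last exact: sqr_ge0.
apply/rowP => i; rewrite mxE; apply/eqP; rewrite -sqrf_eq0.
exact: (implyP (s0 i (mem_index_enum _))).
Qed.

Lemma enorm_gt0 v : (0 < enorm v) = (v != 0).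
Proof. by rewrite lt0r enorm_eq0 enorm_ge0 andbT. Qed.

Lemma enormZ (a : R) v : enorm (a *: v) = `|a| * enorm v.
Proof.
rewrite /enorm -sqrtr_sqr -sqrtrM ?sqr_ge0 // mulr_sumr.
by congr Num.sqrt; apply: eq_bigr => i _; rewrite mxE exprMn.
Qed.

Lemma enormN v : enorm (- v) = enorm v.
Proof. by rewrite -scaleN1r enormZ normrN normr1 mul1r. Qed.

Lemma enormC u v : enorm (u - v) = enorm (v - u).
Proof. by rewrite -enormN opprB. Qed.

(** Cauchy-Schwarz: after multiplication by [2 * (enorm u * enorm v)], positive once both vectors
    are nonzero, it is the sum over i of [(enorm v * u 0 i - enorm u * v 0 i) ^+ 2 >= 0]. *)
Lemma dot_le_enorm u v : \sum_(i < n) u 0 i * v 0 i <= enorm u * enorm v.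
Proof.
have [/eqP|u0] := boolP (u == 0).
  by move=> ->; rewrite big1 ?enorm0 ?mul0r// => i _; rewrite mxE mul0r.
have [/eqP|v0] := boolP (v == 0).
  by move=> ->; rewrite big1 ?enorm0 ?mulr0// => i _; rewrite mxE mulr0.
have a0 : 0 < enorm u by rewrite enorm_gt0.
have b0 : 0 < enorm v by rewrite enorm_gt0.
rewrite -(@ler_pM2l _ (2 * (enorm u * enorm v))) ?mulr_gt0// mulr_sumr.
apply: (@le_trans _ _ (\sum_(i < n) (enorm v ^+ 2 * u 0 i ^+ 2 +
                                     enorm u ^+ 2 * v 0 i ^+ 2))).
  apply: ler_sum => i _; rewrite -subr_ge0.
  have := sqr_ge0 (enorm v * u 0 i - enorm u * v 0 i).
  by congr (0 <= _); ring.
rewrite big_split/= -!mulr_sumr -!sqr_enorm le_eqVlt; apply/orP; left.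
by apply/eqP; ring.
Qed.

Lemma enormD u v : enorm (u + v) <= enorm u + enorm v.
Proof.
rewrite -(@ler_pXn2r _ 2) ?nnegrE ?addr_ge0 ?enorm_ge0//.
rewrite sqr_enorm (eq_bigr (fun i => u 0 i ^+ 2 + v 0 i ^+ 2 +
  2 * (u 0 i * v 0 i))); last by move=> i _; rewrite mxE; ring.
rewrite !big_split/= -mulr_sumr -!sqr_enorm.
by have := dot_le_enorm u v; lra.
Qed.

Lemma enorm_triangle w u v : enorm (u - v) <= enorm (u - w) + enorm (w - v).
Proof. by apply: le_trans (enormD _ _); rewrite addrA subrK. Qed.

Lemma ler_enormB u v : enorm u - enorm v <= enorm (u - v).
Proof. by rewrite lerBlDr; apply: le_trans (enormD _ _); rewrite subrK. Qed.

Lemma normr_le_enorm v : `|v| <= enorm v.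
Proof.
rewrite /Num.norm/= mx_normrE; apply: bigmax_le => [|[i j] _ /=].
  exact: enorm_ge0.
rewrite -(@ler_pXn2r _ 2) ?nnegrE ?enorm_ge0// sqr_enorm ord1 real_normK ?num_real//.
by rewrite (bigD1 j)//= lerDl sumr_ge0// => k _; exact: sqr_ge0.
Qed.

Lemma enorm_le_normr v : enorm v <= n%:R * `|v|.
Proof.
have entry i : `|v 0 i| <= `|v|.
  rewrite [leRHS]/Num.norm/= mx_normrE.
  exact: (le_bigmax_cond 0 (fun ij => `|v ij.1 ij.2|) (j := (0, i))).
rewrite -(@ler_pXn2r _ 2) ?nnegrE ?enorm_ge0 ?mulr_ge0// sqr_enorm.
apply: (@le_trans _ _ (\sum_(i < n) `|v| ^+ 2)).
  apply: ler_sum => i _; rewrite -real_normK ?num_real//.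
  by rewrite ler_pXn2r ?nnegrE.
rewrite sumr_const card_ord -[leLHS]mulr_natl exprMn ler_wpM2r ?sqr_ge0//.
by rewrite -natrX ler_nat; case: (n) => // k; rewrite expnS leq_pmulr.
Qed.

(** The neighbourhoods come from the sup norm; the two comparisons of norms allow every later
    estimate to be Euclidean. *)
Lemma nbhs_enormP p (U : set 'rV[R]_n) :
  nbhs p U <-> exists2 e : R, 0 < e & forall x, enorm (x - p) < e -> U x.
Proof.
split=> [/(@nbhs_normP R _ p U)[e e0 eU]|[e e0 eU]].
  exists e => // x xe; apply: eU => /=; rewrite distrC.
  exact: le_lt_trans (normr_le_enorm _) xe.
(* The successor keeps the divisor positive in dimension 0. *)
apply/(@nbhs_normP R _ p U); exists (e / n.+1%:R); first by rewrite /= divr_gt0.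
move=> x /=; rewrite distrC ltr_pdivlMr ?ltr0n// => xe; apply: eU.
apply: le_lt_trans (enorm_le_normr _) _; apply: le_lt_trans xe.
by rewrite mulrC ler_wpM2l// ler_nat.
Qed.

Lemma near_enorm_lt p (e : R) : 0 < e -> \forall x \near p, enorm (x - p) < e.
Proof. by move=> e0; apply/nbhs_enormP; exists e. Qed.

Lemma cvg_enormP {T : Type} {F : set_system T} {FF : Filter F}
    (f : T -> 'rV[R]_n) p :
  f @ F --> p <-> forall e : R, 0 < e -> \forall i \near F, enorm (f i - p) < e.
Proof.
split=> [fp e e0|fp U /nbhs_enormP[e e0 eU]].
  exact: (fp _ (near_enorm_lt p _ e0)).
by apply: filterS (fp e e0) => i; exact: eU.
Qed.

Lemma cvg_enorm {T : Type} {F : set_system T} {FF : Filter F}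
    (f : T -> 'rV[R]_n) p : f @ F --> p -> enorm (f i) @[i --> F] --> enorm p.
Proof.
move=> fp; apply/cvgrPdist_lt => e e0.
move/cvg_enormP: fp => /(_ _ e0); apply: filterS => i; apply: le_lt_trans.
by rewrite ler_norml lerNl opprB ler_enormB enormC ler_enormB.
Qed.

Lemma closure_enormP p (S : set 'rV[R]_n) :
  closure S p <->
  forall e : R, 0 < e -> exists2 x, S x & enorm (x - p) < e.
Proof.
split=> [cp e e0|sp U /nbhs_enormP[e e0 eU]].
  by have [x [Sx xe]] := cp _ (near_enorm_lt p _ e0); exists x.
by have [x Sx xe] := sp _ e0; exists x; split => //; exact: eU.
Qed.

Lemma enorm_lt_eq0 v : (forall e : R, 0 < e -> enorm v < e) -> v = 0.
Proof.
move=> v0; apply/eqP/negPn/negP; rewrite -enorm_gt0 => /v0.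
by rewrite ltxx.
Qed.

End enorm.

(** The Euclidean bound keeps the sequence in a sup-norm ball, which is compact. The free [N] says
    that [v] is approached along arbitrarily late indices. *)
Lemma enorm_bounded_cluster (R : realType) (n : nat) (u : nat -> 'rV[R]_n)
    (M : R) :
  (forall k, enorm (u k) <= M) ->
  exists v, forall (e : R) N, 0 < e ->
    exists2 k, (N <= k)%N & enorm (u k - v) < e.
Proof.
move=> uM.
pose K := [set v : 'rV[R]_n | `|v| <= M].
have cK : compact K.
  apply: bounded_closed_compact.
    by exists M; split; [exact: num_real | move=> x Mx v /= /le_trans; apply; exact: ltW].
  have -> : K = (@Num.norm R _) @^-1` [set x | x <= M] by [].
  apply: closed_comp; [move=> v _; exact: norm_continuous | exact: closed_le].
have [|v [_ cv]] := cK (u @ \oo) _.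
  by exists 0%N => // k _ /=; exact: le_trans (normr_le_enorm _) (uM k).
exists v => e N e0.
have [|_ [[k Nk <-] ke]] := cv (u @` [set k | (N <= k)%N]) _ _
  (near_enorm_lt v _ e0).
  by exists N => // k Nk; exists k.
by exists k.
Qed.

(** * Tangent cones and directional bundles by approximation *)

Section cones.
Context {R : realType} {n : nat}.
Implicit Types (A B : set 'rV[R]_n) (p q u v w : 'rV[R]_n).

Lemma direction_set_cone (S : set 'rV[R]_n) a : S a -> cone S a.
Proof. by move=> Sa; exists a => //; exists 1; rewrite ?scale1r. Qed.

Lemma cone_scale (S : set 'rV[R]_n) v (t : R) :
  0 <= t -> cone S v -> cone S (t *: v).
Proof.
move=> t0 [a Sa [s s0 ->]]; exists a => //; exists (t * s).
  exact: mulr_ge0.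
by rewrite scalerA.
Qed.

Lemma cone0 (S : set 'rV[R]_n) v : cone S v -> cone S 0.
Proof. by move=> /(cone_scale _ _ _ (lexx 0)); rewrite scale0r. Qed.

(* Only the apex 0 needs care: it lies in a cone exactly when the cone is
   nonempty, and then the cone has nonzero elements. *)
Lemma cone_unit (S : set 'rV[R]_n) v :
  (forall a, S a -> enorm a = 1) -> cone S v -> exists2 a, cone S a & a != 0.
Proof.
move=> S1 [a Sa _]; exists a; first exact: direction_set_cone.
by rewrite -enorm_gt0 S1.
Qed.

Lemma tangent_cone_unit A p v :
  tangent_cone A p v -> exists2 a, tangent_cone A p a & a != 0.
Proof. by apply: cone_unit => a []. Qed.

Lemma LGD_unit A v : LGD A v -> exists2 a, LGD A a & a != 0.
Proof. by apply: cone_unit => a []. Qed.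

Lemma cone_direction (S : set 'rV[R]_n) v :
  (forall a, S a -> enorm a = 1) -> v != 0 -> cone S v ->
  S ((enorm v)^-1 *: v).
Proof.
move=> S1 v0 [a Sa [t t0 vE]].
have Ev : enorm v = t by rewrite vE enormZ S1// mulr1 ger0_norm.
rewrite Ev vE scalerA mulVf ?scale1r// -Ev enorm_eq0//.
Qed.

Lemma cone_of_direction (S : set 'rV[R]_n) v :
  v != 0 -> S ((enorm v)^-1 *: v) -> cone S v.
Proof.
move=> v0 Sv; exists ((enorm v)^-1 *: v) => //.
exists (enorm v); first exact: enorm_ge0.
by rewrite scalerA mulfV ?scale1r// enorm_eq0.
Qed.

Lemma enorm_direction v : v != 0 -> enorm ((enorm v)^-1 *: v) = 1.
Proof.
move=> v0; rewrite enormZ ger0_norm ?invr_ge0 ?enorm_ge0// mulVf//.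
by rewrite enorm_eq0.
Qed.

(** Replaces unit directions by quotients at a free scale [s], the form in which difference
    quotients of a map appear. The case [v = 0] is excluded: the right side then holds at an
    isolated point of [A], where the cone is empty. *)
Lemma tangent_coneP A p v : v != 0 ->
  tangent_cone A p v <->
  forall e : R, 0 < e -> exists s x,
    [/\ 0 < s, s < e, A x & enorm (s^-1 *: (x - p) - v) < e].
Proof.
move=> v0; split.
  move=> [a [a1 [x [Ax xp xa]]] [t t0 vE]] e e0.
  have {}t0 : 0 < t.
    by rewrite lt0r t0 andbT; apply: contraNneq v0 => t0'; rewrite vE t0' scale0r.
  have [N1 _ /(_ _ (leqnn _))/= Nx] :
      \forall i \near \oo, forall j, (i <= j)%N -> enorm (x j - p) < e * t /\
        enorm (direction p (x j) - a) < e / t.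
    have : \forall i \near \oo, enorm (x i - p) < e * t /\
        enorm (direction p (x i) - a) < e / t.
      apply: filterI.
        by move/cvg_enormP: xp; apply; rewrite mulr_gt0.
      by move/cvg_enormP: xa; apply; rewrite divr_gt0.
    move=> [N _ Nx]; exists N => // i /= Ni j ij.
    by apply: Nx => /=; exact: leq_trans ij.
  have [x1 x2] := Nx _ (leqnn _).
  have [AxN xNp] := Ax N1.
  have xN0 : 0 < enorm (x N1 - p) by rewrite enorm_gt0 subr_eq0; apply/eqP.
  (* With this scale the quotient is [t] times the direction of [x N1], to be compared with
     [v = t *: a]. *)
  exists (enorm (x N1 - p) / t), (x N1); split => //.
  - by rewrite divr_gt0.
  - by rewrite ltr_pdivrMr.
  rewrite vE invf_div -scalerA -scalerBr enormZ gtr0_norm//.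
  by rewrite mulrC -ltr_pdivlMr.
move=> H; apply: cone_of_direction => //.
have Ev : 0 < enorm v by rewrite enorm_gt0.
(* The bound [enorm v] keeps the quotients [z k] away from 0, hence [x k] away from [p]; the bound
   1/(k+1) makes them converge. *)
pose e k : R := Num.min (enorm v) k.+1%:R^-1.
have e0 k : 0 < e k by rewrite lt_min Ev invr_gt0 ltr0n.
have ee : e k @[k --> \oo] --> 0.
  apply/cvgrPdist_lt => d d0; have := @cvg_harmonic R.
  move=> /cvgrPdist_lt/(_ _ d0); apply: filterS => k.
  rewrite /harmonic/= !sub0r !normrN; apply: le_lt_trans.
  by rewrite !ger0_norm ?invr_ge0 ?(ltW (e0 k))// ge_min lexx orbT.
have /choice[s /choice[x sx]] k := H _ (e0 k).
pose z k := (s k)^-1 *: (x k - p).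
have zv : z k @[k --> \oo] --> v.
  apply/cvg_enormP => d d0; move/cvgrPdist_lt: ee => /(_ _ d0).
  apply: filterS => k; rewrite sub0r normrN gtr0_norm//; apply: lt_trans.
  by have [] := sx k.
have xE k : x k - p = s k *: z k.
  have [s0 _ _ _] := sx k.
  by rewrite /z scalerA mulfV ?gt_eqF// scale1r.
have z0 k : z k != 0.
  apply/negP => /eqP zk; have [_ _ _] := sx k.
  by rewrite -/(z k) zk sub0r enormN lt_min ltxx.
have s0 : s k @[k --> \oo] --> 0.
  apply/cvgrPdist_lt => d d0; move/cvgrPdist_lt: ee => /(_ _ d0).
  apply: filterS => k; rewrite !sub0r !normrN gtr0_norm//; apply: le_lt_trans.
  by have [sk ske _ _] := sx k; rewrite gtr0_norm// ltW.
split; first exact: enorm_direction.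
exists x; split.
- move=> k; have [sk _ Axk _] := sx k; split => // xp.
  move: (z0 k); rewrite -(inj_eq (scalerI (lt0r_neq0 sk))) -xE xp subrr.
  by rewrite scaler0 eqxx.
- have -> : x = fun k => s k *: z k + p.
    by apply/funext => k; rewrite -xE subrK.
  rewrite -[X in _ --> X]add0r -(scale0r v).
  by apply: cvgD; [exact: cvgZ | exact: cvg_cst].
have -> : (fun k => direction p (x k)) = fun k => (enorm (z k))^-1 *: z k.
  apply/funext => k; have [sk _ _ _] := sx k.
  rewrite /direction xE enormZ gtr0_norm// scalerA invfM mulrAC mulVf ?mul1r//.
  by rewrite gt_eqF.
apply: cvgZ => //; apply: cvgV; first by rewrite enorm_eq0.
exact: cvg_enorm.
Qed.

(** Normalisation is continuous away from 0, so approximating a nonzero [v] by tangent vectors of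
    any length amounts to approximating its direction on the sphere. *)
Lemma LGDP A v : v != 0 ->
  LGD A v <->
  forall e : R, 0 < e -> exists q u,
    [/\ A q, enorm q < e, tangent_cone A q u & enorm (u - v) < e].
Proof.
move=> v0; split.
  move=> [a [a1 ca] [t t0 vE]] e e0.
  have {}t0 : 0 < t.
    by rewrite lt0r t0 andbT; apply: contraNneq v0 => t0'; rewrite vE t0' scale0r.
  have N : nbhs ((0, a) : 'rV[R]_n * 'rV[R]_n)
      [set qb | enorm (qb.1 - 0) < e /\ enorm (qb.2 - a) < e / t].
    exists ([set q | enorm (q - 0) < e], [set b | enorm (b - a) < e / t]) => //=.
    by split; apply: near_enorm_lt => //; rewrite divr_gt0.
  have [[q b] [[/= Aq qb] [qe be]]] := ca _ N.
  exists q, (t *: b); split => //; first by rewrite -[q]subr0.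
    by apply: cone_scale; [exact: ltW | exact: direction_set_cone].
  by rewrite vE -scalerBr enormZ gtr0_norm// mulrC -ltr_pdivlMr.
move=> H; apply: cone_of_direction => //; split; first exact: enorm_direction.
have Ev : 0 < enorm v by rewrite enorm_gt0.
set a := _ *: v => W [[W1 W2]] /= [/nbhs_enormP[e1 e10 W1e]].
move=> /nbhs_enormP[e2 e20 W2e] W12.
(* [enorm v] forces [u] to be nonzero. The last bound is halved because normalising [u] and [v]
   turns their distance into at most [2 * enorm (u - v) / enorm v]. *)
have [|q [u [Aq qe qu ue]]] :=
    H (Num.min e1 (Num.min (enorm v) (e2 * enorm v / 2))).
  by rewrite !lt_min e10 Ev !mulr_gt0.
move: qe ue; rewrite !lt_min => /and3P[q1 _ _] /and3P[_ uv u2].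
have u0 : u != 0.
  by apply: contraTneq uv => ->; rewrite sub0r enormN ltxx.
have Eu : 0 < enorm u by rewrite enorm_gt0.
exists (q, (enorm u)^-1 *: u); split.
  by split=> //=; apply: cone_direction => // b [].
apply: W12; split => /=; first by apply: W1e; rewrite subr0.
apply: W2e; rewrite -(ltr_pM2l Ev) -[X in X * enorm _]gtr0_norm// -enormZ.
rewrite scalerBr scalerA mulrC /a scalerA mulfV ?gt_eqF// scale1r.
apply: le_lt_trans (enorm_triangle u _ _) _.
rewrite -[X in enorm (_ - X)]scale1r -scalerBl enormZ.
have -> : (enorm u)^-1 * enorm v - 1 = (enorm u)^-1 * (enorm v - enorm u).
  by rewrite mulrBr mulVf ?gt_eqF.
rewrite normrM [`|_^-1|]gtr0_norm ?invr_gt0// mulrAC mulVf ?gt_eqF// mul1r.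
have : `|enorm v - enorm u| <= enorm (u - v).
  by rewrite ler_norml lerNl opprB ler_enormB enormC ler_enormB.
lra.
Qed.

Lemma LGD_subset A B : A `<=` B -> LGD A `<=` LGD B.
Proof.
move=> AB v [a [a1 ca] ta]; exists a => //; split => //.
apply: closureS ca => -[q b] /= [Aq [b1 [x [Ax xq xb]]]].
split; first exact: AB.
by split => //; exists x; split => // i; have [/AB] := Ax i.
Qed.

(** The scales [t] are prescribed in advance. (SSP) is applied to the points [p + t k *: v], whose
    direction is constant; as their distance to [p] is [t k * enorm v], its error is o(t). *)
Lemma SSP_tangent A p v (t : nat -> R) :
  SSP A p -> v != 0 -> tangent_cone A p v ->
  (forall k, 0 < t k) -> t k @[k --> \oo] --> 0 ->
  exists2 b, forall k, A (b k) & (t k)^-1 *: (b k - p) @[k --> \oo] --> v.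
Proof.
move=> sA v0 Av t0 tc.
have Ev : 0 < enorm v by rewrite enorm_gt0.
have aE k : (p + t k *: v) - p = t k *: v by rewrite addrAC subrr add0r.
have [|||b [Ab ab _]] := sA (fun k => p + t k *: v).
- move=> k /eqP; rewrite -subr_eq0 aE scaler_eq0 (negbTE v0) gt_eqF//.
- rewrite -[X in _ --> X]addr0 -(scale0r v).
  by apply: cvgD; [exact: cvg_cst | apply: cvgZ tc (cvg_cst v)].
- exists ((enorm v)^-1 *: v).
    by apply: cone_direction => // a [].
  rewrite (_ : (fun _ => _) = fun=> (enorm v)^-1 *: v); first exact: cvg_cst.
  apply/funext => k; rewrite /direction aE enormZ gtr0_norm// scalerA.
  by rewrite invfM mulrAC mulVf ?mul1r// gt_eqF.
exists b => //; apply/cvg_enormP => e e0.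
move/cvgrPdist_lt: ab => /(_ (e / enorm v)); rewrite divr_gt0// => /(_ isT).
apply: filterS => k; rewrite sub0r normrN ger0_norm; last first.
  by rewrite divr_ge0 ?enorm_ge0.
rewrite aE enormZ gtr0_norm// ltr_pdivrMr ?mulr_gt0// mulrCA -mulrA.
rewrite mulVf ?gt_eqF// mulr1 => H.
rewrite -(ltr_pM2l (t0 k)) -[X in X * _]gtr0_norm// -enormZ scalerBr scalerA.
by rewrite mulfV ?gt_eqF// scale1r -addrA -opprD enormC.
Qed.

End cones.

(** * Bi-Lipschitz maps and their Arzelà-Ascoli derivatives *)

Definition bilipschitz_on {R : realType} {n : nat} (L : R)
    (U : set 'rV[R]_n) (f : 'rV[R]_n -> 'rV[R]_n) : Prop :=
  forall x y, U x -> U y ->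
    enorm (f x - f y) <= L * enorm (x - y) /\
    enorm (x - y) <= L * enorm (f x - f y).

Section arzela_ascoli.
Context {R : realType} {n : nat}.
Implicit Types (A U : set 'rV[R]_n) (p v w : 'rV[R]_n) (f g : 'rV[R]_n -> 'rV[R]_n).

Lemma bilip_germ_bilipschitz (h : bilip_germ R n) :
  exists2 L : R, 0 < L & bilipschitz_on L (bl_dom h) h.
Proof.
have [L1 h1] := bl_fun_lip h; have [L2 h2] := bl_inv_lip h.
(* The given constants may be negative or zero, while a common positive one is needed as a divisor
   later. *)
exists (`|L1| + `|L2| + 1) => [|x y Ux Uy].
  by rewrite ltr_wpDl// addr_ge0.
have le1 (L : R) : L <= `|L| by exact: ler_norm.
split.
  apply: le_trans (h1 _ _ Ux Uy) _; rewrite ler_wpM2r ?enorm_ge0//.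
  by have := le1 L1; have := normr_ge0 L2; lra.
rewrite -{1}(bl_funK Ux) -{1}(bl_funK Uy).
apply: le_trans (h2 _ _ (bl_fun_cod Ux) (bl_fun_cod Uy)) _.
rewrite ler_wpM2r ?enorm_ge0//.
by have := le1 L2; have := normr_ge0 L1; lra.
Qed.

Lemma bilipschitz_eq0 (L : R) g v :
  bilipschitz_on L setT g -> g 0 = 0 -> (g v == 0) = (v == 0).
Proof.
move=> gL g0; apply/eqP/eqP => [gv|->//].
have [_] := gL v 0 I I; rewrite gv g0 !subrr enorm0 mulr0 subr0 => v0.
by apply/eqP; rewrite -enorm_eq0 eq_le v0 enorm_ge0.
Qed.

(** Both inequalities are closed conditions, so they pass to pointwise limits. It serves twice: from
    difference quotients to [d_p h], and from [d_p h] to the limit map. *)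
Lemma bilipschitz_limit {T : Type} {F : set_system T} {FF : ProperFilter F}
    (L : R) (a : T -> 'rV[R]_n -> 'rV[R]_n) g :
  (forall x y, \forall i \near F,
    enorm (a i x - a i y) <= L * enorm (x - y) /\
    enorm (x - y) <= L * enorm (a i x - a i y)) ->
  (forall x, a i x @[i --> F] --> g x) ->
  bilipschitz_on L setT g.
Proof.
move=> aL ag x y _ _.
have agxy : enorm (a i x - a i y) @[i --> F] --> enorm (g x - g y).
  by apply: cvg_enorm; exact: cvgB.
split.
  apply: (@closed_cvg _ _ F _ (fun i => enorm (a i x - a i y))
    [set r | r <= L * enorm (x - y)]) agxy; first exact: closed_le.
  by apply: filterS (aL x y) => i [].
have : L * enorm (a i x - a i y) @[i --> F] --> L * enorm (g x - g y).
  by apply: cvgM => //; exact: cvg_cst.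
apply: (@closed_cvg _ _ F _ (fun i => L * enorm (a i x - a i y))
  [set r | enorm (x - y) <= r]); first exact: closed_ge.
by apply: filterS (aL x y) => i [].
Qed.

Lemma AA_limit_cvg (D : set 'rV[R]_n) dh ht v :
  AA_limit D dh ht -> dh p v @[p --> within D (nbhs (0 : 'rV[R]_n))] --> ht v.
Proof.
by move/fam_cvgP => /(_ [set v] (@compact_set1 _ v)); rewrite uniform_set1.
Qed.

Lemma AA_derivative_cvg f p g : AA_derivative f p g ->
  exists t : nat -> R, [/\ forall i, 0 < t i, t i @[i --> \oo] --> 0
    & forall v, (t i)^-1 *: (f (p + t i *: v) - f p) @[i --> \oo] --> g v].
Proof.
move=> [t [t0 tc /fam_cvgP tg]]; exists t; split => // v.
by have := tg [set v] (@compact_set1 _ v); rewrite uniform_set1.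
Qed.

Lemma AA_derivative0 f p g : AA_derivative f p g -> g 0 = 0.
Proof.
move=> /AA_derivative_cvg[t [_ _ /(_ 0)]].
rewrite (_ : (fun _ => _) = fun=> 0).
  by move/(cvg_lim (@norm_hausdorff _ _)) <-; exact/lim_cst/norm_hausdorff.
by apply/funext => i; rewrite scaler0 addr0 subrr scaler0.
Qed.

Lemma cvg_addZ (t : nat -> R) (p : 'rV[R]_n) (z : nat -> 'rV[R]_n) v :
  t i @[i --> \oo] --> 0 -> z i @[i --> \oo] --> v ->
  p + t i *: z i @[i --> \oo] --> p.
Proof.
move=> tc zc; rewrite -[X in _ --> X]addr0 -(scale0r v).
by apply: cvgD; [exact: cvg_cst | exact: cvgZ].
Qed.

Lemma AA_derivative_bilipschitz (L : R) U f p g :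
  nbhs p U -> bilipschitz_on L U f -> AA_derivative f p g ->
  bilipschitz_on L setT g.
Proof.
move=> Up fL /AA_derivative_cvg[t [t0 tc tg]].
apply: bilipschitz_limit tg => x y.
have Ux v : \forall i \near \oo, U (p + t i *: v).
  by have := cvg_addZ _ p _ _ tc (cvg_cst v); exact.
near=> i.
have [] : enorm (f (p + t i *: x) - f (p + t i *: y)) <=
    L * enorm ((p + t i *: x) - (p + t i *: y)) /\
    enorm ((p + t i *: x) - (p + t i *: y)) <=
    L * enorm (f (p + t i *: x) - f (p + t i *: y)).
  by apply: fL; near: i; exact: Ux.
rewrite opprD addrACA subrr add0r -scalerBr enormZ gtr0_norm//.
rewrite -[X in _ -> enorm X <= _ /\ _ <= _ * enorm X]scalerBr opprB addrA subrK.
rewrite enormZ gtr0_norm ?invr_gt0// [L * (_^-1 * _)]mulrCA.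
by rewrite ler_pdivrMl// ler_pdivlMl// [t i * (L * _)]mulrCA.
Unshelve. all: by end_near. Qed.

Lemma enorm_quotient (t : R) (x p v : 'rV[R]_n) : 0 < t ->
  t * enorm (t^-1 *: (x - p) - v) = enorm (x - (p + t *: v)).
Proof.
move=> t0; rewrite -[X in X * _]gtr0_norm// -enormZ scalerBr scalerA.
by rewrite mulfV ?gt_eqF// scale1r opprD addrA.
Qed.

(* Along the times t that define g, the points p + t v of a line may be
   replaced by points of A, by (SSP), at the cost of an error o(t). *)
Lemma AA_derivative_tangent (L : R) U A f p g v :
  nbhs p U -> bilipschitz_on L U f -> AA_derivative f p g ->
  SSP A p -> tangent_cone A p v ->
  tangent_cone (f @` (A `&` U)) (f p) (g v).
Proof.
move=> Up fL fg sA.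
have gL := AA_derivative_bilipschitz _ _ _ _ _ Up fL fg.
have g0 := AA_derivative0 _ _ _ fg.
(* For the zero vector only nonemptiness of the target cone is at stake, and the image of a nonzero
   tangent vector provides it. *)
suff H w : w != 0 -> tangent_cone A p w ->
    tangent_cone (f @` (A `&` U)) (f p) (g w).
  have [->|] := eqVneq v 0; last exact: H.
  by move=> /tangent_cone_unit[a Aa a0]; rewrite g0; exact/cone0/(H a).
move: w => {}v v0 Av.
have [t [t0 tc tg]] := AA_derivative_cvg _ _ _ fg.
have [b Ab bv] := SSP_tangent _ _ _ _ sA v0 Av t0 tc.
apply/tangent_coneP; first by rewrite (bilipschitz_eq0 _ _ _ gL).
have bE : b = fun i => p + t i *: ((t i)^-1 *: (b i - p)).
  apply/funext => i.
  by rewrite scalerA mulfV ?gt_eqF// scale1r addrC subrK.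
have bp : b i @[i --> \oo] --> p by rewrite bE; exact: cvg_addZ tc bv.
have tp : p + t i *: v @[i --> \oo] --> p.
  by apply: cvg_addZ => //; exact: cvg_cst.
move=> e e0.
near (\oo : set_system nat) => i.
have Ubi : U (b i) by near: i; exact: (bp _ Up).
have Uti : U (p + t i *: v) by near: i; exact: (tp _ Up).
exists (t i), (f (b i)); split => //; last 2 first.
- by exists (b i).
- have := fL _ _ Ubi Uti => -[fbi _].
  have H1 : enorm ((t i)^-1 *: (f (p + t i *: v) - f p) - g v) < e / 2.
    by near: i; have /cvg_enormP := tg v; apply; rewrite divr_gt0.
  have H2 : `|L| * enorm ((t i)^-1 *: (b i - p) - v) < e / 2.
    (* Adding 1 makes the factor positive, so that it can be divided by. *)
    apply: (@le_lt_trans _ _ ((`|L| + 1) *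
        enorm ((t i)^-1 *: (b i - p) - v))).
      by rewrite ler_wpM2r ?enorm_ge0// lerDl.
    rewrite mulrC -ltr_pdivlMr ?ltr_wpDl//.
    by near: i; move/cvg_enormP: bv; apply; rewrite !divr_gt0// ltr_wpDl.
  have H3 : enorm ((t i)^-1 *: (f (b i) - f p) -
      (t i)^-1 *: (f (p + t i *: v) - f p)) <=
      `|L| * enorm ((t i)^-1 *: (b i - p) - v).
    rewrite -scalerBr opprB addrA subrK.
    rewrite enormZ gtr0_norm ?invr_gt0// ler_pdivrMl//.
    apply: le_trans fbi _.
    by rewrite mulrCA enorm_quotient// ler_wpM2r ?enorm_ge0// ler_norm.
  have := enorm_triangle ((t i)^-1 *: (f (p + t i *: v) - f p))
    ((t i)^-1 *: (f (b i) - f p)) (g v).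
  lra.
near: i; move/cvgrPdist_lt: tc => /(_ _ e0); apply: filterS => i.
by rewrite sub0r normrN; apply: le_lt_trans; exact: ler_norm.
Unshelve. all: by end_near. Qed.

(* The preimages under f of points of the image approaching in direction w
   have difference quotients staying in a bounded set: their cluster points
   are tangent to A and are mapped to w. *)
Lemma AA_derivative_tangent_onto (L : R) U A f p g w : 0 < L ->
  nbhs p U -> bilipschitz_on L U f -> AA_derivative f p g ->
  SSP (f @` (A `&` U)) (f p) -> tangent_cone (f @` (A `&` U)) (f p) w ->
  exists2 v, tangent_cone A p v & g v = w.
Proof.
move=> L0 Up fL fg sB.
have gL := AA_derivative_bilipschitz _ _ _ _ _ Up fL fg.
have g0 := AA_derivative0 _ _ _ fg.
suff H u : u != 0 -> tangent_cone (f @` (A `&` U)) (f p) u ->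
    exists2 v, tangent_cone A p v & g v = u.
  have [->|] := eqVneq w 0; last exact: H.
  move=> /tangent_cone_unit[a Aa a0]; have [v Av _] := H a a0 Aa.
  by exists 0 => //; exact: cone0 Av.
move: u => {}w w0 Bw.
have [t [t0 tc tg]] := AA_derivative_cvg _ _ _ fg.
have [b Bb bw] := SSP_tangent _ _ _ _ sB w0 Bw t0 tc.
have /choice[x xP] i : exists x, [/\ A x, U x & f x = b i].
  by have [x [Ax Ux] fx] := Bb i; exists x.
have Upp : U p := nbhs_singleton Up.
pose u i := (t i)^-1 *: (x i - p).
have uE i : enorm (u i) <= L * enorm ((t i)^-1 *: (b i - f p)).
  have [_ Ux <-] := xP i; have [_ H] := fL _ _ Ux Upp.
  rewrite /u !enormZ gtr0_norm ?invr_gt0// mulrCA.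
  by rewrite ler_wpM2l// invr_ge0 ltW.
(* From [N] on the image quotients have norm below [1 + enorm w], hence the [u i] are bounded by [L]
   times that; the sequence is shifted by [N] before a cluster point is taken. *)
have [N _ NP] : \forall i \near \oo,
    enorm ((t i)^-1 *: (b i - f p) - w) < 1.
  by move/cvg_enormP: bw; apply.
have [|v vP] := @enorm_bounded_cluster _ _ (fun i => u (N + i)%N)
    (L * (1 + enorm w)).
  move=> i; apply: le_trans (uE _) _; rewrite ler_pM2l//.
  have := NP (N + i)%N (leq_addr _ _).
  have := ler_enormB ((t (N + i)%N)^-1 *: (b (N + i)%N - f p)) w.
  by rewrite /=; lra.
(* Instead of extracting a subsequence: any eventual property holds at some index where [u i] is
   also close to [v]. *)
have vI (e : R) (P : set nat) : 0 < e -> (\forall i \near \oo, P i) ->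
    exists2 i, P i & enorm (u i - v) < e.
  move=> e0 [M _ MP]; have [k Mk ke] := vP e M e0.
  by exists (N + k)%N => //; apply: MP => /=; exact: leq_trans (leq_addl _ _).
have gv : g v = w.
  apply/eqP; rewrite -subr_eq0; apply/eqP/enorm_lt_eq0 => e e0.
  (* Three errors separate [g v] from [w]: from [g v] to the quotient at [p + t i *: v], from there
     to the quotient at [x i] (at most [L * enorm (u i - v)]), and from there to [w]. *)
  have e3 : 0 < e / 3 by rewrite divr_gt0.
  have tv : p + t i *: v @[i --> \oo] --> p.
    by apply: cvg_addZ => //; exact: cvg_cst.
  have [|i [[Uv gv] bi] uv] := vI (e / 3 / L) (fun i => (U (p + t i *: v) /\
      enorm ((t i)^-1 *: (f (p + t i *: v) - f p) - g v) < e / 3) /\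
      enorm ((t i)^-1 *: (b i - f p) - w) < e / 3) (divr_gt0 e3 L0).
    apply: filterI; last by move/cvg_enormP: bw; apply.
    apply: filterI; first exact: (tv _ Up).
    by move/cvg_enormP: (tg v); apply.
  have [_ Ux fx] := xP i; have [H _] := fL _ _ Ux Uv.
  have H3 : enorm ((t i)^-1 *: (f (p + t i *: v) - f p) -
      (t i)^-1 *: (b i - f p)) < e / 3.
    rewrite -fx enormC -scalerBr opprB addrA subrK enormZ.
    rewrite gtr0_norm ?invr_gt0// ltr_pdivrMl//; apply: le_lt_trans H _.
    move: uv; rewrite ltr_pdivlMr// -(ltr_pM2l (t0 i)) mulrA enorm_quotient//.
    by rewrite mulrC.
  have := enorm_triangle ((t i)^-1 *: (f (p + t i *: v) - f p)) (g v) w.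
  have := enorm_triangle ((t i)^-1 *: (b i - f p))
    ((t i)^-1 *: (f (p + t i *: v) - f p)) w.
  by rewrite (enormC (g v) (_ *: _)); lra.
exists v => //; apply/tangent_coneP.
  by rewrite -(bilipschitz_eq0 _ _ _ gL)// gv.
move=> e e0; have [|i te ue] := vI e (fun i => t i < e) e0.
  move/cvgrPdist_lt: tc => /(_ _ e0); apply: filterS => i.
  by rewrite sub0r normrN; apply: le_lt_trans; exact: ler_norm.
by exists (t i), (x i); split => //; have [] := xP i.
Qed.

End arzela_ascoli.

(** * Limits of derivatives and the two inclusions *)

Section directional.
Context {R : realType} {n : nat}.
Implicit Types (A D E : set 'rV[R]_n) (h : bilip_germ R n) (p v w : 'rV[R]_n)
  (dh dk : 'rV[R]_n -> 'rV[R]_n -> 'rV[R]_n) (ht kt : 'rV[R]_n -> 'rV[R]_n).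

Lemma bl_dom_near h : \forall p \near (0 : 'rV[R]_n), nbhs p (bl_dom h).
Proof. exact: nbhs_interior (bl_dom_nbhs h). Qed.

Lemma bl_fun_near0 h (P : set 'rV[R]_n) :
  nbhs (0 : 'rV[R]_n) P -> \forall p \near (0 : 'rV[R]_n), P (h p).
Proof.
have [L L0 hL] := bilip_germ_bilipschitz h => /nbhs_enormP[e e0 eP].
have eL : 0 < e / L by rewrite divr_gt0.
apply: filterS2 (bl_dom_nbhs h) (near_enorm_lt 0 _ eL) => p Up; rewrite subr0.
rewrite ltr_pdivlMr// mulrC => pe; apply: eP; rewrite subr0.
have [+ _] := hL p 0 Up (nbhs_singleton (bl_dom_nbhs h)).
by rewrite bl_fun0 !subr0 => /le_lt_trans; apply.
Qed.

Lemma near_AA_bilipschitz h (L : R) D dh :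
  bilipschitz_on L (bl_dom h) h -> AA_family h D dh ->
  \forall p \near (0 : 'rV[R]_n), D p ->
    [/\ nbhs p (bl_dom h), AA_derivative h p (dh p),
        bilipschitz_on L setT (dh p) & dh p 0 = 0].
Proof.
move=> hL; apply: filterS2 (bl_dom_near h) => p Up dp Dp; split => //.
- exact: dp.
- exact: AA_derivative_bilipschitz Up hL (dp Dp).
- exact: AA_derivative0 (dp Dp).
Qed.

Lemma closure_within D : closure D 0 -> ProperFilter (within D (nbhs (0 : 'rV[R]_n))).
Proof. by move=> D0; apply: within_nbhs_proper. Qed.

Lemma AA_limit_bilipschitz h (L : R) D dh ht :
  bilipschitz_on L (bl_dom h) h -> closure D 0 -> AA_family h D dh ->
  AA_limit D dh ht -> bilipschitz_on L setT ht /\ ht 0 = 0.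
Proof.
move=> hL /closure_within FD hD Dht; have hDn := near_AA_bilipschitz _ _ _ _ hL hD.
split.
  apply: (@bilipschitz_limit _ _ _ _ FD L dh) => [x y|x].
    by apply: filterS hDn => p + Dp => /(_ Dp)[_ _ dL _]; exact: dL.
  exact: AA_limit_cvg Dht.
apply: enorm_lt_eq0 => e e0.
have /cvg_enormP/(_ _ e0) H := AA_limit_cvg _ _ _ 0 Dht.
have H0 : \forall p \near within D (nbhs (0 : 'rV[R]_n)), dh p 0 = 0.
  by apply: filterS hDn => p + Dp => /(_ Dp)[].
have [p [-> ]] := @filter_ex _ _ FD _ (filterI H0 H).
by rewrite sub0r enormN.

Qed.

Lemma directional_along_LGD h A D dh ht :
  directional_along h A D dh ht -> ht @` LGD A `<=` LGD (germ_image h A).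
Proof.
move=> [[DA D0] hD Dht tD cD] _ [v Av <-].
have [L L0 hL] := bilip_germ_bilipschitz h.
have [htL ht0] := AA_limit_bilipschitz _ _ _ _ _ hL D0 hD Dht.
suff H u : u != 0 -> LGD A u -> LGD (germ_image h A) (ht u).
  have [v0|] := eqVneq v 0; last by move=> v0; exact: H.
  have [a Aa a0] := LGD_unit _ _ Av.
  by rewrite v0 ht0; exact: cone0 (H a a0 Aa).
move: u => {Av}v v0 Av.
apply/LGDP; first by rewrite (bilipschitz_eq0 _ _ _ htL).
move=> e e0; have e2 : 0 < e / 2 by rewrite divr_gt0.
(* All requirements on the base point are collected in one neighbourhood of 0, so that [cones_cover]
   yields a point of [D] meeting them together with a vector tangent there and close to [v]. *)
pose U : set 'rV[R]_n := [set p | (D p -> enorm (dh p v - ht v) < e / 2) /\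
  ((D p -> [/\ nbhs p (bl_dom h), AA_derivative h p (dh p),
             bilipschitz_on L setT (dh p) & dh p 0 = 0]) /\
  ((D p -> dh p @` tangent_cone A p `<=` tangent_cone (germ_image h A) (h p)) /\
   enorm (h p) < e))].
have NU : nbhs (0 : 'rV[R]_n) U.
  apply: filterI.
    by have /cvg_enormP := AA_limit_cvg _ _ _ v Dht; apply.
  apply: filterI; first exact: near_AA_bilipschitz.
  apply: filterI => //; apply: (bl_fun_near0 h (fun q => enorm q < e)).
  by apply: filterS (near_enorm_lt 0 _ e0) => q; rewrite subr0.
have /closure_enormP/(_ (e / 2 / L) (divr_gt0 e2 L0))[u [p [Up Dp] Au] uv] :=
  cD _ NU v Av.
case: Up => /(_ Dp) pv [/(_ Dp)[Np _ dL _] [/(_ Dp) tp pe]].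
exists (h p), (dh p u); split => //.
- by exists p => //; split; [exact: DA | exact: nbhs_singleton].
- by apply: tp; exists u.
have [+ _] := dL u v I I; have := enorm_triangle (dh p v) (dh p u) (ht v).
by move: uv; rewrite ltr_pdivlMr// mulrC; lra.
Qed.

Lemma germ_image_inv h A : germ_image (germ_inv h) (germ_image h A) `<=` A.
Proof. by move=> _ [_ [[x [Ax Ux] <-] _]] /= <-; rewrite bl_funK. Qed.

Lemma germ_inv_LGD_cancel h A D dh ht E dk kt :
  directional_along (germ_inv h) (germ_image h A) E dk kt ->
  cancel ht kt -> LGD (germ_image h A) `<=` ht @` LGD A.
Proof.
move=> kE htK w Bw; exists (kt w).
  apply: LGD_subset (germ_image_inv h A) _ _.
  by apply: directional_along_LGD kE _ _; exists w.
case: kE => [[_ E0] kE Ekt _ _].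
have [L L0 kL] := bilip_germ_bilipschitz (germ_inv h).
have [ktL _] := AA_limit_bilipschitz _ _ _ _ _ kL E0 kE Ekt.
(* [ht (kt w)] and [w] have the same image under [kt], by [htK]; the lower Lipschitz bound of [kt]
   identifies them. *)
have [_] := ktL (ht (kt w)) w I I; rewrite htK subrr enorm0 mulr0 => H.
by apply/eqP; rewrite -subr_eq0 -enorm_eq0 eq_le H enorm_ge0.
Qed.

(** The inclusion of [E] in the image of [D] makes each base point in [E] some [h p] with [p] in
    [D], where [dh p] is controlled by [ht]. *)
Lemma LGD_germ_image_sub h A D dh ht E :
  SSP_near0 (germ_image h A) -> D `<=` A -> closure D 0 ->
  AA_family h D dh -> AA_limit D dh ht ->
  cones_cover (germ_image h A) E -> E `<=` germ_image h D ->
  LGD (germ_image h A) `<=` ht @` LGD A.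
Proof.
move=> sB DA D0 hD Dht cE ED.
have [L L0 hL] := bilip_germ_bilipschitz h.
have [htL ht0] := AA_limit_bilipschitz _ _ _ _ _ hL D0 hD Dht.
suff H u : u != 0 -> LGD (germ_image h A) u -> exists2 v, LGD A v & ht v = u.
  move=> w Bw; have [w0|w0] := eqVneq w 0; last exact: H.
  have [a Ba a0] := LGD_unit _ _ Bw; have [v Av _] := H a a0 Ba.
  by exists 0; [exact: cone0 Av | rewrite w0].
move: u => w w0 Bw.
have approx (e : R) : 0 < e -> exists p u,
    [/\ D p, enorm p < e, tangent_cone A p u,
        bilipschitz_on L setT (dh p) & enorm (dh p u - w) < e /\ dh p 0 = 0].
  move=> e0; have eL : 0 < e / L by rewrite divr_gt0.
  pose P p := (D p -> [/\ nbhs p (bl_dom h), AA_derivative h p (dh p),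
             bilipschitz_on L setT (dh p) & dh p 0 = 0]) /\
     (closure (germ_image h A) (h p) -> SSP (germ_image h A) (h p)).
  have [r r0 rP] : exists2 r : R, 0 < r & forall p, enorm (p - 0) < r -> P p.
    apply/nbhs_enormP; apply: filterI; first exact: near_AA_bilipschitz.
    exact: (bl_fun_near0 h (fun q => closure (germ_image h A) q -> _) sB).
  (* Since [enorm p <= L * enorm q] for [q = h p], a point [q] within [d] of 0 has its preimage
     within both [e] and [r]. *)
  pose d := Num.min (e / L) (r / L).
  have d0 : 0 < d by rewrite lt_min !divr_gt0.
  have /closure_enormP/(_ _ e0)[u [q [qd Eq] Bu] uw] :=
    cE _ (near_enorm_lt 0 _ d0) w Bw.
  have [p [Dp Up] pq] := ED _ Eq.
  have : enorm p <= L * enorm q.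
    have [_] := hL p 0 Up (nbhs_singleton (bl_dom_nbhs h)).
    by rewrite bl_fun0 !subr0 pq.
  move: qd; rewrite /= subr0 lt_min !ltr_pdivlMr// ![_ * L]mulrC.
  move=> /andP[qe qr] pLq.
  have [] := rP p; first by rewrite subr0; exact: le_lt_trans qr.
  move=> /(_ Dp)[Np hp dL d00] sp.
  have Bp : germ_image h A (h p) by exists p => //; split => //; exact: DA.
  have [|v Av vu] := AA_derivative_tangent_onto _ _ _ _ _ _ u L0 Np hL hp
    (sp (subset_closure Bp)).
    by rewrite pq.
  exists p, v; split => //; first exact: le_lt_trans qe.
  by rewrite vu.
have /choice[p /choice[u pu]] k := approx _ (divr_gt0 ltr01 (ltr0Sn R k)).
have inv1 k : 1 / k.+1%:R <= 1 :> R.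
  by rewrite ler_pdivrMr ?ltr0n// mul1r ler1n.
(* The lower Lipschitz bound of [dh (p k)], which fixes 0, bounds [u k] by [L] times the norm of its
   image, and the image is within 1 of [w]. *)
have [|v vP] := enorm_bounded_cluster _ _ u (L * (1 + enorm w)).
  move=> k; have [_ _ _ dL [dw d00]] := pu k; have [_] := dL (u k) 0 I I.
  rewrite d00 !subr0 => /le_trans; apply; rewrite ler_pM2l//.
  by have := ler_enormB (dh (p k) (u k)) w; have := lt_le_trans dw (inv1 k); lra.
have small (e : R) : 0 < e ->
    exists2 k, enorm (u k - v) < e & 1 / k.+1%:R <= e.
  move=> e0; have [N _ NP] := (@cvgrPdist_lt _ _ _ _ _ _ _).1 (@cvg_harmonic R) e e0.
  have [k Nk ke] := vP e N e0; exists k => //.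
  by have := NP k Nk; rewrite sub0r normrN /= ger0_norm// div1r => /ltW.
have vw : ht v = w.
  apply/eqP; rewrite -subr_eq0; apply/eqP/enorm_lt_eq0 => e e0.
  (* Three errors below e/4 lead from [ht v] to [w], through [dh (p k) v] and [dh (p k) (u k)]; the
     bound [r] makes the first one small. *)
  have e4 : 0 < e / 4 by rewrite divr_gt0.
  have /cvg_enormP/(_ _ e4)/nbhs_enormP[r r0 rP] := AA_limit_cvg _ _ _ v Dht.
  have [|k uv kd] := small (Num.min (e / 4) (Num.min r (e / 4 / L))).
    by rewrite !lt_min e4 r0 divr_gt0.
  have [Dp pk Au dL [dw _]] := pu k.
  have [+ _] := dL (u k) v I I; move: uv kd; rewrite !lt_min !le_min.
  rewrite !ltr_pdivlMr// [_ * L]mulrC => /and3P[_ _ uv] /and3P[k4 kr _] duv.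
  have : enorm (dh (p k) v - ht v) < e / 4.
    by apply: rP => //; rewrite subr0; exact: lt_le_trans kr.
  rewrite enormC.
  have := enorm_triangle (dh (p k) v) (ht v) w.
  have := enorm_triangle (dh (p k) (u k)) (dh (p k) v) w.
  rewrite (enormC (dh (p k) v) (dh (p k) (u k))).
  have := lt_le_trans dw k4; lra.
exists v => //; apply/LGDP; first by rewrite -(bilipschitz_eq0 _ _ _ htL)// vw.
move=> e e0; have [k ue ke] := small _ e0; have [Dp pk Au _ _] := pu k.
by exists (p k), (u k); split => //; [exact: DA | exact: lt_le_trans ke].
Qed.

(** Only the transport of tangent cones has to be proved; it follows from (SSP) at the points of [D]
    near 0, which lie in the closure of [A]. *)
Lemma directional_along_SSP h A D dh ht :
  SSP_near0 A -> D `<=` A -> closure D 0 -> cones_cover A D ->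
  AA_family h D dh -> AA_limit D dh ht -> directional_along h A D dh ht.
Proof.
move=> sA DA D0 cD hD Dht; split => //.
have [L _ hL] := bilip_germ_bilipschitz h.
apply: filterS3 (bl_dom_near h) sA hD => p Up sp dp Dp _ [v Av <-].
apply: AA_derivative_tangent Up hL (dp Dp) _ Av.
exact/sp/subset_closure/DA.
Qed.

End directional.

Theorem theorem4p7 (R : realType) (n : nat) (A : set 'rV[R]_n)
    (h : bilip_germ R n) (D : set 'rV[R]_n)
    (dh : 'rV[R]_n -> 'rV[R]_n -> 'rV[R]_n) (ht : 'rV[R]_n -> 'rV[R]_n) :
  closure A 0 ->
  SSP_near0 A ->
  D `<=` A ->
  closure D 0 ->
  cones_cover A D ->
  AA_family h D dh ->
  AA_limit D dh ht ->
  [/\ directional h A,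
      ht @` LGD A `<=` LGD (germ_image h A)
    & SSP_near0 (germ_image h A) ->
      (exists E dk kt,
        directional_along (germ_inv h) (germ_image h A) E dk kt /\
        compatible h D ht E kt) ->
      ht @` LGD A = LGD (germ_image h A)].
Proof.
move=> _ sA DA D0 cD hD Dht.
have hA := directional_along_SSP _ _ _ _ _ sA DA D0 cD hD Dht.
have htA := directional_along_LGD _ _ _ _ _ hA.
split => // [|sB [E [dk [kt [kE compat]]]]]; first by exists D, dh, ht.
apply/seteqP; split => //.
case: compat => [ED|htK]; last exact: germ_inv_LGD_cancel kE htK.
(* Directionality of the inverse enters here through the cones of the image along [E]. *)
by case: kE => _ _ _ _ cE; exact: LGD_germ_image_sub sB DA D0 hD Dht cE ED.
Qed.
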